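(* Let $\mathbb{K}$ be an algebraically closed field of characteristic zero, $\mathcal{C}\subset\mathbb{K}^2$ an affine irreducible plane curve, $A=(a,b)\in\mathbb{K}^2$, and assume that $\mathcal{C}_0\neq\emptyset$, that $\mathcal{C}$ is not a circle centered at $A$, and that $\mathcal{C}$ is not a line passing through $A$. Then for all but finitely many $d\in\mathbb{K}\setminus\{0\}$, all irreducible components of $\mathfrak{C}(\mathcal{C},A,d)$ are simple.
   Context: For $\mathcal{C}$ defined by an irreducible polynomial $f(y_1,y_2)$ and $d\in\mathbb{K}\setminus\{0\}$: $\mathfrak{B}(\mathcal{C},A,d)\subset\mathbb{K}^2\times\mathbb{K}^2\times\mathbb{K}$ is the set of $(\bar x,\bar y,w)$ with $f(y_1,y_2)=0$, $(x_1-y_1)^2+(x_2-y_2)^2=d^2$, $(y_2-b)(x_1-y_1)-(y_1-a)(x_2-y_2)=0$, $w((y_1-a)^2+(y_2-b)^2)=1$; $\pi_1,\pi_2$ are the projections $(\bar x,\bar y,w)\mapsto\bar x$, $\mapsto\bar y$; the conchoid $\mathfrak{C}(\mathcal{C},A,d)$ is the Zariski closure of $\pi_1(\mathfrak{B}(\mathcal{C},A,d))$. $\mathcal{C}_0=\{(p_1,p_2)\in\mathcal{C}:(p_1-a)^2+(p_2-b)^2\neq0\}$. An irreducible component $\mathcal{M}$ of $\mathfrak{C}(\mathcal{C},A,d)$ is simple if there is a non-empty Zariski dense $\Omega\subset\mathcal{M}$ with $\mathrm{Card}(\pi_2(\pi_1^{-1}(Q)))=1$ for all $Q\in\Omega$;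 otherwise special. A circle centered at $A$ of radius $r$ is $(y_1-a)^2+(y_2-b)^2=r^2$. *)

(* Defs.v *)
From HB Require Import structures.
From mathcomp Require Import all_boot all_order all_algebra.
From mathcomp Require Import mpoly.
Set Implicit Arguments. Unset Strict Implicit. Unset Printing Implicit Defensive.
Import Order.TTheory GRing.Theory.
Local Open Scope ring_scope.

Section Conchoid.
Variable K : fieldType.

Definition ev2 (p : {mpoly K[2]}) (x : K * K) : K :=
  p.@[fun i : 'I_2 => if val i == 0%N then x.1 else x.2].

(* irreducible polynomial in K[y1,y2]: non-constant, and only trivial factorizations
   (units of K[y1,y2] are the nonzero constants) *)
Definition mirreducible (f : {mpoly K[2]}) : Prop :=
  (1 < msize f)%N /\
  forall g h : {mpoly K[2]}, f = g * h -> (msize g <= 1)%N \/ (msize h <= 1)%N.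

Definition zclosed (Z : K * K -> Prop) : Prop :=
  exists S : {mpoly K[2]} -> Prop, forall x, Z x <-> (forall p, S p -> ev2 p x = 0).

Definition zclosure (X : K * K -> Prop) : K * K -> Prop :=
  fun x => forall Z, zclosed Z -> (forall y, X y -> Z y) -> Z x.

Definition zirreducible (Z : K * K -> Prop) : Prop :=
  [/\ zclosed Z, exists x, Z x &
      forall Z1 Z2, zclosed Z1 -> zclosed Z2 -> (forall x, Z x <-> Z1 x \/ Z2 x) ->
        (forall x, Z x <-> Z1 x) \/ (forall x, Z x <-> Z2 x)].

Definition irr_component (M Z : K * K -> Prop) : Prop :=
  [/\ zirreducible M, (forall x, M x -> Z x) &
      forall M', zirreducible M' -> (forall x, M x -> M' x) ->
        (forall x, M' x -> Z x) -> forall x, M' x -> M x].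

Definition curve (f : {mpoly K[2]}) : K * K -> Prop := fun y => ev2 f y = 0.

Definition Bset (f : {mpoly K[2]}) (a b d : K) (x y : K * K) (w : K) : Prop :=
  [/\ ev2 f y = 0,
      (x.1 - y.1) ^+ 2 + (x.2 - y.2) ^+ 2 = d ^+ 2,
      (y.2 - b) * (x.1 - y.1) - (y.1 - a) * (x.2 - y.2) = 0 &
      w * ((y.1 - a) ^+ 2 + (y.2 - b) ^+ 2) = 1].

Definition conchoid (f : {mpoly K[2]}) (a b d : K) : K * K -> Prop :=
  zclosure (fun x => exists y w, Bset f a b d x y w).

Definition fiber (f : {mpoly K[2]}) (a b d : K) (Q : K * K) : K * K -> Prop :=
  fun y => exists w, Bset f a b d Q y w.

Definition simple_comp (f : {mpoly K[2]}) (a b d : K) (M : K * K -> Prop) : Prop :=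
  exists Om : K * K -> Prop,
    [/\ forall q, Om q -> M q, exists q, Om q,
        (forall q, zclosure Om q <-> M q) &
        forall Q, Om Q -> exists! y, fiber f a b d Q y].

End Conchoid.

(* Main.v *)
Require Import Defs.
From HB Require Import structures.
From mathcomp Require Import all_boot all_order all_algebra.
From mathcomp Require Import mpoly.
From mathcomp Require Import ring.
From Stdlib Require Import Classical ClassicalEpsilon.
Import Order.TTheory GRing.Theory.
Local Open Scope ring_scope.

Set Implicit Arguments. Unset Strict Implicit. Unset Printing Implicit Defensive.

(* Every point of the plane off the isotropic lines through A = (a, b) is
   A + r u_k, with u_k the unit vector ((k + 1/k)/2, (k - 1/k)/(2i)), and (k, r)
   is unique up to sign. If y = A + r u_k lies on C, the corresponding points of
   the conchoid are A + (r + d) u_k, up to the choice of sign of (k, r). Hence a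
   point other than A with two preimages gives two roots r, r + 2d of the
   polynomial G_k(r) = k^n f(A + r u_k). Fix k0 outside the zeros of the leading
   coefficient of G. If 2d is not a difference of two roots of G_k0, the
   resultant in r of G_k(r) and G_k(r + 2d) is a nonzero polynomial in k, so only
   finitely many lines through A carry such a pair; likewise, if -d is not a
   root of G_k0, only finitely many points of C are mapped to A. No G_k vanishes
   identically since C is not a line through A, so the curve G = 0 has no isolated
   points and the points with a single preimage are dense in the conchoid.
   Noetherianity of the plane makes them dense in each irreducible component. *)

(** * Noetherian rings *)

Definition ideal (R : comNzRingType) (J : R -> Prop) : Prop :=
  [/\ J 0, forall x y, J x -> J y -> J (x + y) & forall c x, J x -> J (c * x)].

Definition gen (R : comNzRingType) (S : R -> Prop) (x : R) : Prop :=
  forall J, ideal J -> (forall y, S y -> J y) -> J x.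

Definition before (T : Type) (a : nat -> T) (n : nat) (y : T) : Prop :=
  exists2 i, (i < n)%N & y = a i.

(** A sequence form of the ascending chain condition, directly applicable to polynomials chosen
    along a descending chain of closed sets. *)
Definition noetherian (R : comNzRingType) : Prop :=
  forall a : nat -> R, exists n, gen (before a n) (a n).

Lemma ideal_gen (R : comNzRingType) (S : R -> Prop) : ideal (gen S).
Proof.
split=> [J [] //|x y gx gy J idJ SJ|c x gx J idJ SJ].
  by case: (idJ) => _ addJ _; apply: addJ; [apply: gx|apply: gy].
by case: (idJ) => _ _ mulJ; apply: mulJ; apply: gx.
Qed.

Lemma mem_gen (R : comNzRingType) (S : R -> Prop) x : S x -> gen S x.
Proof. by move=> Sx J _; apply. Qed.

Lemma gen_trans (R : comNzRingType) (S S' : R -> Prop) x :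
  (forall y, S y -> gen S' y) -> gen S x -> gen S' x.
Proof. by move=> SS'; apply => //; apply: ideal_gen. Qed.

Lemma gen_before_le (R : comNzRingType) (a : nat -> R) m n x :
  (m <= n)%N -> gen (before a m) x -> gen (before a n) x.
Proof.
move=> lemn; apply: gen_trans => y [i ltim ->]; apply: mem_gen.
by exists i => //; apply: leq_trans lemn.
Qed.

Lemma idealB (R : comNzRingType) (J : R -> Prop) x y :
  ideal J -> J x -> J y -> J (x - y).
Proof.
by case=> _ addJ mulJ Jx Jy; apply: addJ => //; rewrite -mulN1r; apply: mulJ.
Qed.

Lemma noetherian_field (F : fieldType) : noetherian F.
Proof.
move=> a; have [a0|a0] := eqVneq (a 0%N) 0.
  by exists 0%N => J [J0 _ _] _; rewrite a0.
exists 1%N => J [_ _ mulJ] SJ.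
by rewrite -(divfK a0 (a 1%N)); apply: mulJ; apply: SJ; exists 0%N.
Qed.

(* The coefficients of index m of the members of J of degree at most m form an
   ideal: Hilbert's basis theorem applies the hypothesis on R to it. *)
Lemma ideal_coef (R : comNzRingType) (J : {poly R} -> Prop) m :
  ideal J ->
  ideal (fun c => exists g, [/\ J g, (size g <= m.+1)%N & g`_m = c]).
Proof.
case=> J0 addJ mulJ; split=> [|x y [g [Jg sg <-]] [h [Jh sh <-]]|c x [g [Jg sg <-]]].
- by exists 0; rewrite coef0 size_poly0.
- exists (g + h); rewrite coefD; split=> //; first exact: addJ.
  by rewrite (leq_trans (size_polyD _ _)) // geq_max sg sh.
- exists (c%:P * g); rewrite coefCM; split=> //; first exact: mulJ.
  by rewrite mul_polyC (leq_trans (size_scale_leq _ _)).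
Qed.

Lemma exists_argmin (T : Type) (Q : T -> Prop) (mu : T -> nat) :
  (exists x, Q x) -> exists2 x, Q x & forall y, Q y -> (mu x <= mu y)%N.
Proof.
case=> x; move: {2}(mu x) (leqnn (mu x)) => n; elim: n x => [|n IHn] x le_n Qx.
  by exists x => // y _; apply: leq_trans le_n _.
case: (classic (exists2 y, Q y & (mu y <= n)%N)) => [[y Qy]|noy].
  by move/IHn; apply.
exists x => // y Qy; apply: (leq_trans le_n); rewrite ltnNge; apply/negP => le.
by apply: noy; exists y.
Qed.

(** Suppose no term of [P] depends on the earlier ones. Repeatedly choose [f n] of least degree in
    the ideal [I] of all terms but outside the ideal of the previous choices. Over R some leading
    coefficient depends on the earlier ones, so [f n] can be lowered in degree without leaving the
    eligible set. *)
Theorem noetherian_poly (R : comNzRingType) :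
  noetherian R -> noetherian {poly R}.
Proof.
move=> noethR P; apply: NNPP => /not_ex_all_not nP.
pose I x := exists n, gen (before P n) x.
have idI : ideal I.
  split=> [|x y [m gx] [n gy]|c x [n gx]]; first by exists 0%N => J [].
    exists (maxn m n); case: (ideal_gen (before P (maxn m n))) => _ addG _.
    by apply: addG; [apply: gen_before_le gx|apply: gen_before_le gy];
      rewrite ?leq_maxl ?leq_maxr.
  by exists n; case: (ideal_gen (before P n)) => _ _; apply.
(* Each choice depends on the set of all previous ones, so the recursion builds that set [T n] and
   reads off [f n] from it. *)
pose least S g := (I g /\ ~ gen S g) /\
  forall h, I h /\ ~ gen S h -> (size g <= size h)%N.
pose pick S := epsilon (inhabits (0 : {poly R})) (least S).
pose T := fix T n := if n is n'.+1 then fun y => T n' y \/ y = pick (T n')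
                     else fun=> False.
pose f n := pick (T n).
have TE n y : T n y <-> before f n y.
  elim: n y => [|n IHn] y /=; first by split=> // -[].
  split=> [[/IHn [i lti ->]|->]|[i]]; first by exists i => //; apply: ltnW.
    by exists n.
  rewrite ltnS leq_eqVlt => /predU1P[-> ->|lti ->]; first by right.
  by left; apply/IHn; exists i.
have leastf n : (exists N, forall y, T n y -> gen (before P N) y) -> least (T n) (f n).
  case=> N TN; apply: (epsilon_spec (inhabits (0 : {poly R})) (least (T n))).
  suff [g ? ?] : exists2 g, I g /\ ~ gen (T n) g &
      forall h, I h /\ ~ gen (T n) h -> (size g <= size h)%N by exists g.
  apply: exists_argmin; exists (P N); split.
    by exists N.+1; apply: mem_gen; exists N.
  by move/(gen_trans TN); apply: nP.
(* Finitely many choices involve finitely many terms of [P]; the next term then lies outside their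
   ideal, so a further choice exists. *)
have Tbound n : exists N, forall y, T n y -> gen (before P N) y.
  elim: n => [|n IHn]; first by exists 0%N.
  case: (leastf n IHn) => -[[m fm] _] _; case: IHn => N TN.
  exists (maxn m N) => y /= [/TN|->].
    by apply: gen_before_le; exact: leq_maxr.
  by apply: gen_before_le fm; exact: leq_maxl.
have leastF n : least (T n) (f n) by apply: leastf.
have sub_T m n y : (m <= n)%N -> T m y -> T n y.
  move=> lemn /TE [i lti ->]; apply/TE; exists i => //; exact: leq_trans lemn.
have size_f m n : (m <= n)%N -> (size (f m) <= size (f n))%N.
  move=> lemn; case: (leastF m) => _; apply; case: (leastF n) => -[In nGn] _.
  split=> // Gm; apply: nGn; apply: gen_trans Gm => y Ty.
  by apply: mem_gen; apply: sub_T Ty.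
have f_neq0 n : f n != 0.
  by apply/eqP => f0; case: (leastF n) => -[_] + _; rewrite f0; apply=> J [].
have [n] := noethR (fun n => lead_coef (f n)).
pose m := (size (f n)).-1; pose G := gen (T n).
have idG : ideal G by apply: ideal_gen.
have size_fn : size (f n) = m.+1 by rewrite prednK // lt0n size_poly_eq0.
(* Degrees of the choices increase, so multiplying [f i] by a power of ['X] moves its leading
   coefficient to index [m]. This yields [g] in [G] with the leading term of [f n], and [f n - g]
   contradicts minimality. *)
case/(_ _ (ideal_coef m idG)) => [y [i ltin ->]|g [Gg sg gm]].
  have sizei := size_f _ _ (ltnW ltin).
  have sizefi : size (f i) = (size (f i)).-1.+1 by rewrite prednK // lt0n size_poly_eq0.
  exists ('X^(m - (size (f i)).-1) * f i); split.
  - by case: idG => _ _; apply; apply: mem_gen; apply/TE; exists i.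
  - apply: (leq_trans (size_polyMleq _ _)); rewrite size_polyXn addSn /=.
    by rewrite {2}sizefi addnS ltnS subnK // -ltnS -sizefi -size_fn.
  - rewrite coefXnM ifF.
      by rewrite subKn // -ltnS -sizefi -size_fn.
    by apply/negbTE; rewrite -leqNgt leq_subr.
case: (leastF n) => -[In nGn] minf; have subG x : G x -> I x.
  by case: (Tbound n) => N TN /(gen_trans TN) ?; exists N.
have := minf (f n - g); rewrite size_fn leqNgt ltnS => /(_ _)/negP; apply.
  split; first by apply: (idealB idI) => //; apply: subG.
  move=> Gfg; apply: nGn; rewrite -(subrK g (f n)).
  by case: (idG) => _ addG _; apply: addG.
apply/leq_sizeP => j; rewrite leq_eqVlt coefB => /predU1P[<-|ltj].
  by rewrite gm lead_coefE subrr.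
by rewrite !nth_default ?subrr // ?size_fn // (leq_trans sg).
Qed.

(** * The Zariski topology of the plane *)

(** A non-accessible element has a smaller non-accessible one; iterating this choice gives an
    infinite descent. *)
Lemma wf_no_descent (T : Type) (lt : T -> T -> Prop) :
  (forall s : nat -> T, ~ forall n, lt (s n.+1) (s n)) -> well_founded lt.
Proof.
move=> nodesc x0; apply: NNPP => nx0.
have next (x : {x | ~ Acc lt x}) : {y : {x | ~ Acc lt x} | lt (sval y) (sval x)}.
  case: x => x nx; apply: constructive_indefinite_description => /=.
  apply: NNPP => noy; apply: nx; split=> y ltyx; apply: NNPP => ny.
  by apply: noy; exists (exist _ y ny).
pose s n := iter n (fun x => sval (next x)) (exist _ x0 nx0).
by apply: (nodesc (fun n => sval (s n))) => n; apply: (svalP (next (s n))).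
Qed.

Section Evaluation.
Variable K : fieldType.
Implicit Types (p q : {mpoly K[2]}) (x : K * K).

Definition ord2_0 : 'I_2 := ord0.
Definition ord2_1 : 'I_2 := ord_max.

Lemma ev2D p q x : ev2 (p + q) x = ev2 p x + ev2 q x.
Proof. exact: mevalD. Qed.
Lemma ev2M p q x : ev2 (p * q) x = ev2 p x * ev2 q x.
Proof. exact: mevalM. Qed.
Lemma ev2C c x : ev2 c%:MP x = c.
Proof. exact: mevalC. Qed.
Lemma ev2X0 x : ev2 'X_ord2_0 x = x.1.
Proof. by rewrite /ev2 mevalXU. Qed.
Lemma ev2X1 x : ev2 'X_ord2_1 x = x.2.
Proof. by rewrite /ev2 mevalXU. Qed.

Lemma mpoly2_ind (Q : {mpoly K[2]} -> Prop) :
  (forall c, Q c%:MP) -> Q 'X_ord2_0 -> Q 'X_ord2_1 ->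
  (forall p q, Q p -> Q q -> Q (p + q)) ->
  (forall p q, Q p -> Q q -> Q (p * q)) -> forall p, Q p.
Proof.
move=> QC QX0 QX1 QD QM.
have QX i n : Q 'X_i -> Q ('X_i ^+ n).
  move=> Qi; elim: n => [|n IHn]; first by rewrite expr0 -mpolyC1; apply: QC.
  by rewrite exprS; apply: QM.
elim/mpolyind => [|c m p _ _ Qp]; first by rewrite -mpolyC0; apply: QC.
apply: QD => //; rewrite -mul_mpolyC mpolyXE_id big_ord_recl big_ord1.
have <- : ord2_1 = lift ord0 ord0 by apply: val_inj.
by apply: (QM _ _ (QC c)); apply: QM; apply: QX.
Qed.

(** Iterated univariate polynomials, with the second coordinate as outer variable, allow
    [noetherian_poly] to be applied twice. *)
Lemma ev2_poly p : exists P : {poly {poly K}}, forall x, P.[x.2%:P].[x.1] = ev2 p x.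
Proof.
elim/mpoly2_ind: p => [c|||p q [P EP] [Q EQ]|p q [P EP] [Q EQ]].
- by exists c%:P%:P => x; rewrite !hornerC ev2C.
- by exists 'X%:P => x; rewrite hornerC hornerX ev2X0.
- by exists 'X => x; rewrite hornerX hornerC ev2X1.
- by exists (P + Q) => x; rewrite !hornerD EP EQ ev2D.
- by exists (P * Q) => x; rewrite !hornerM EP EQ ev2M.
Qed.

End Evaluation.

Section Zariski.
Variable K : fieldType.
Implicit Types (X Y Z M : K * K -> Prop).

Lemma zclosureS X x : X x -> zclosure X x.
Proof. by move=> Xx Z _; apply. Qed.

Lemma zclosure_min X Z x : zclosed Z -> (forall y, X y -> Z y) -> zclosure X x -> Z x.
Proof. by move=> cZ XZ; apply. Qed.

Lemma zclosureP X x :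
  zclosure X x <-> forall p, (forall y, X y -> ev2 p y = 0) -> ev2 p x = 0.
Proof.
split=> [Xx p pX|Xx Z [S ZS] XZ].
  by apply: (Xx (fun y => ev2 p y = 0)) => //; exists (eq p) => y; split=> [+ _ <- //|]; apply.
by apply/ZS => p Sp; apply: Xx => y /XZ /ZS; apply.
Qed.

Lemma zclosed_zclosure X : zclosed (zclosure X).
Proof. by exists (fun p => forall y, X y -> ev2 p y = 0) => x; apply: zclosureP. Qed.

Lemma zclosed0 : zclosed (fun _ : K * K => False).
Proof.
exists (eq 1%:MP) => x; split=> // /(_ _ erefl) /eqP.
by rewrite ev2C oner_eq0.
Qed.

Lemma zclosedU Y Z : zclosed Y -> zclosed Z -> zclosed (fun x => Y x \/ Z x).
Proof.
move=> [S YS] [T ZT]; exists (fun r => exists p q, [/\ S p, T q & r = p * q]) => x.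
split=> [YZx r [p [q [Sp Tq ->]]]|STx]; rewrite ?ev2M.
  by case: YZx => [/YS/(_ p Sp)|/ZT/(_ q Tq)] ->; rewrite ?mul0r ?mulr0.
apply: NNPP => /not_or_and [nY nZ]; apply: nY; apply/YS => p Sp.
apply: NNPP => px; apply: nZ; apply/ZT => q Tq.
have /eqP := STx (p * q) (ex_intro _ p (ex_intro _ q (And3 Sp Tq erefl))).
by rewrite ev2M mulf_eq0 => /orP[/eqP|/eqP].
Qed.

Lemma zclosedI Y Z : zclosed Y -> zclosed Z -> zclosed (fun x => Y x /\ Z x).
Proof.
move=> [S YS] [T ZT]; exists (fun p => S p \/ T p) => x; split.
  by move=> [/YS Sx /ZT Tx] p [/Sx|/Tx].
by move=> STx; split; [apply/YS|apply/ZT] => p ?; apply: STx; [left|right].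
Qed.

Lemma zirreducible_sub M Y Z :
  zirreducible M -> zclosed Y -> zclosed Z -> (forall x, M x -> Y x \/ Z x) ->
  (forall x, M x -> Y x) \/ (forall x, M x -> Z x).
Proof.
move=> [cM _ irrM] cY cZ MYZ.
case: (irrM _ _ (zclosedI cM cY) (zclosedI cM cZ)) => [x|H|H].
- by split=> [Mx|[[]|[]] //]; case: (MYZ x Mx); [left|right].
- by left=> x /H [].
- by right=> x /H [].
Qed.

Definition zlt Y Z : Prop :=
  [/\ zclosed Y, zclosed Z, forall x, Y x -> Z x & ~ forall x, Z x -> Y x].

(** Along a descending chain choose polynomials vanishing on the next set but not on the current
    one. One of them lies in the ideal of its predecessors, all of which vanish on its current set:
    a contradiction. *)
Lemma wf_zlt : well_founded zlt.
Proof.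
apply: wf_no_descent => s slt.
have step n : exists P : {poly {poly K}},
    (forall x, s n.+1 x -> P.[x.2%:P].[x.1] = 0) /\
    exists2 x, s n x & P.[x.2%:P].[x.1] <> 0.
  case: (slt n) => [[S sS]] _ _ nsub; apply: NNPP => noP; apply: nsub => x sx.
  apply/sS => p Sp; apply: NNPP => px; case: (ev2_poly p) => P EP.
  apply: noP; exists P; split=> [y /sS/(_ p Sp)|]; first by rewrite EP.
  by exists x => //; rewrite EP.
pose a n := sval (constructive_indefinite_description _ (step n)).
have sub m n x : (m <= n)%N -> s n x -> s m x.
  move=> /subnK <-; elim: (n - m)%N => // k IHk /=; rewrite addSn => sx.
  by apply: IHk; case: (slt (k + m)%N) => _ _ + _; apply.
have [n an] := noetherian_poly (noetherian_poly (noetherian_field (F := K))) a.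
have [_ [x sx nx]] := svalP (constructive_indefinite_description _ (step n)).
apply: nx; apply: (an (fun P => P.[x.2%:P].[x.1] = 0)).
  split=> [|P Q Px Qx|Q P Px]; first by rewrite !horner0.
    by rewrite !hornerD Px Qx addr0.
  by rewrite !hornerM Px mulr0.
move=> _ [i ltin ->].
have [+ _] := svalP (constructive_indefinite_description _ (step i)).
by apply; apply: sub sx.
Qed.

(* Noetherian induction: if Z is the union of two proper closed subsets, M lies
   in the closure of the part of S contained in one of them. *)
Lemma dense_irreducible Z S M :
  (forall x, Z x <-> zclosure S x) -> zirreducible M -> (forall x, M x -> Z x) ->
  exists N, [/\ zirreducible N, (forall x, M x -> N x), (forall x, N x -> Z x)
    & forall x, N x <-> zclosure (fun y => S y /\ N y) x].
Proof.
elim/(well_founded_ind wf_zlt): Z S => Z IH S ZS irrM MZ.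
have cZ : zclosed Z.
  by case: (zclosed_zclosure S) => P SP; exists P => x; rewrite ZS SP.
have SZ x : S x -> Z x by move=> Sx; apply/ZS; apply: zclosureS.
case: (classic (zirreducible Z)) => [irrZ|redZ].
  exists Z; split=> // x; rewrite ZS; split; apply: zclosure_min;
    try exact: zclosed_zclosure; move=> y; last by case=> ? _; apply: zclosureS.
  by move=> Sy; apply: zclosureS; split=> //; apply: SZ.
(* One half of a decomposition, stated so that it serves for both; the induction runs on the closure
   of [S] cut by [Z1]. *)
have rec Z1 Z2 : zclosed Z1 -> (forall x, Z x <-> Z1 x \/ Z2 x) ->
    ~ (forall x, Z x <-> Z1 x) ->
    (forall x, M x -> zclosure (fun y => S y /\ Z1 y) x) ->
    exists N, [/\ zirreducible N, (forall x, M x -> N x), (forall x, N x -> Z x)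
      & forall x, N x <-> zclosure (fun y => S y /\ N y) x].
  move=> cZ1 ZE ZZ1 MS1; set Y := zclosure (fun y => S y /\ Z1 y).
  have YZ1 x : Y x -> Z1 x by apply: zclosure_min => // y [].
  have YZ x : Y x -> Z x by move/YZ1 => ?; apply/ZE; left.
  have ltYZ : zlt Y Z.
    split=> //; first exact: zclosed_zclosure.
    move=> ZY; apply: ZZ1 => x; split=> [/ZY/YZ1 //|?].
    by apply/ZE; left.
  have [N [irrN MN NY NE]] := IH Y ltYZ (fun y => S y /\ Z1 y) (fun x => iff_refl _) irrM MS1.
  exists N; split=> // [x /NY/YZ //|x]; split.
    by move/NE; apply: zclosure_min; first exact: zclosed_zclosure;
      move=> y [[Sy _] Ny]; apply: zclosureS.
  by apply: zclosure_min => [|y []//]; case: irrN.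
have [Z1 [Z2 [cZ1 cZ2 ZE nZ1 nZ2]]] : exists Z1 Z2, [/\ zclosed Z1, zclosed Z2,
    forall x, Z x <-> Z1 x \/ Z2 x, ~ (forall x, Z x <-> Z1 x)
    & ~ (forall x, Z x <-> Z2 x)].
  apply: NNPP => noZ; apply: redZ; split=> //.
    by case: irrM => _ [x /MZ]; exists x.
  move=> Z1 Z2 cZ1 cZ2 ZE; apply: NNPP => /not_or_and [? ?].
  by apply: noZ; exists Z1, Z2.
have [] := zirreducible_sub irrM (zclosed_zclosure (fun y => S y /\ Z1 y))
    (zclosed_zclosure (fun y => S y /\ Z2 y)).
- move=> x /MZ /ZS; apply: (zclosure_min (Z := fun z =>
      zclosure (fun y => S y /\ Z1 y) z \/ zclosure (fun y => S y /\ Z2 y) z)).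
    by apply: zclosedU; apply: zclosed_zclosure.
  by move=> y Sy; case/ZE: (SZ y Sy) => ?; [left|right]; apply: zclosureS.
- exact: rec.
- by apply: (rec Z2 Z1) => // x; rewrite ZE or_comm.
Qed.

End Zariski.

(** * Families of polynomials in one variable *)

Lemma resultant_neq0_coprimep (R : idomainType) (p q : {poly R}) :
  p != 0 -> (resultant p q != 0) = coprimep p q.
Proof.
move=> p0; rewrite resultant_eq0 -leqNgt leq_eqVlt ltnS leqn0 size_poly_eq0.
by rewrite gcdp_eq0 (negPf p0) orbF coprimep_def.
Qed.

Section Families.
Variable K : closedFieldType.
Implicit Types (G P : {poly {poly K}}) (T c : {poly K}).

(** Inner variable [k] for the direction, outer variable [r] for the position on the line: this is
    the polynomial on the line [k]. *)
Definition spec (k : K) (P : {poly {poly K}}) : {poly K} :=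
  map_poly (horner_eval k) P.

Lemma specD k P Q : spec k (P + Q) = spec k P + spec k Q.
Proof. exact: rmorphD. Qed.
Lemma specM k P Q : spec k (P * Q) = spec k P * spec k Q.
Proof. exact: rmorphM. Qed.
Lemma specX k P n : spec k (P ^+ n) = spec k P ^+ n.
Proof. exact: rmorphXn. Qed.
Lemma specC k c : spec k c%:P = c.[k]%:P.
Proof. exact: map_polyC. Qed.
Lemma spec_X k : spec k 'X = 'X.
Proof. exact: map_polyX. Qed.
Lemma specZ k c P : spec k (c *: P) = c.[k] *: spec k P.
Proof. exact: map_polyZ. Qed.
Lemma coef_spec k P i : (spec k P)`_i = (P`_i).[k].
Proof. by rewrite coef_map. Qed.
Lemma horner_spec k P r : (spec k P).[r] = P.[r%:P].[k].
Proof. by rewrite -[RHS]horner_evalE -horner_map /= /horner_eval hornerC. Qed.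

Lemma horner_spec_shift G e k r :
  (spec k (G \Po ('X + e%:P%:P))).[r] = (spec k G).[r + e].
Proof.
have -> : spec k (G \Po ('X + e%:P%:P)) = spec k G \Po ('X + e%:P).
  by rewrite /spec map_comp_poly rmorphD /= map_polyX map_polyC /= /horner_eval hornerC.
by rewrite horner_comp !hornerE.
Qed.

Lemma size_spec k G : (lead_coef G).[k] != 0 -> size (spec k G) = size G.
Proof. exact: size_map_poly_id0. Qed.

Lemma poly_eq0_generic c T :
  T != 0 -> (forall k, T.[k] != 0 -> c.[k] = 0) -> c = 0.
Proof.
move=> T0 cT; apply/eqP; apply: contraT => c0.
have /closed_nonrootP[k] : c * T != 0 by rewrite mulf_neq0.
rewrite rootE hornerM mulf_eq0 negb_or => /andP[ck Tk].
by rewrite (cT k Tk) eqxx in ck.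
Qed.

(** g splits into linear factors, each dividing p, and [size g] exceeds their number by one. *)
Lemma dvdp_exp_roots (g p : {poly K}) :
  g != 0 -> (forall r, root g r -> root p r) -> g %| p ^+ size g.
Proof.
move=> g0; have [r Eg] := closed_field_poly_normal g => rootgp.
have lg : lead_coef g != 0 by rewrite lead_coef_eq0.
have sg : size g = (size r).+1 by rewrite Eg size_scale // size_prod_XsubC.
have {}rootgp z : z \in r -> root p z.
  by move=> zr; apply: rootgp; rewrite Eg rootZ // root_prod_XsubC.
rewrite {1}Eg dvdpZl // sg exprS dvdp_mull //.
elim: r rootgp {Eg sg} => [|z r IHr] rootgp; first by rewrite big_nil expr0.
rewrite big_cons exprS dvdp_mul //; first by rewrite dvdp_XsubCl rootgp ?mem_head.
by apply: IHr => y yr; apply: rootgp; rewrite inE yr orbT.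
Qed.

(** If c vanishes at k0, so does B there, as [spec k0 G] is nonzero in a domain. Both sides are then
    divided by ['X - k0%:P], which lowers the size of c. *)
Lemma primitive_cancel G (A B : {poly {poly K}}) c k0 :
  c != 0 -> spec k0 G != 0 -> c *: A = B * G ->
  exists c' B', c'.[k0] != 0 /\ c' *: A = B' * G.
Proof.
move=> + Gk0; move: {2}(size c) (leqnn (size c)) => n.
elim: n c B => [|n IHn] c B; first by rewrite leqn0 size_poly_eq0 => ->.
move=> sc c0 E; have [ck0|ck0] := eqVneq c.[k0] 0; last by exists c, B.
have /factor_theorem[q Ec] : root c k0 by apply/eqP.
have X0 : 'X - k0%:P != 0 :> {poly K} by rewrite polyXsubC_eq0.
have Bk0 : spec k0 B = 0.
  have /eqP := congr1 (spec k0) E; rewrite specZ ck0 scale0r specM eq_sym mulf_eq0.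
  by rewrite (negPf Gk0) orbF => /eqP.
pose B1 := map_poly (fun b => b %/ ('X - k0%:P)) B.
have EB : B = ('X - k0%:P) *: B1.
  apply/polyP => i; rewrite coefZ coef_map_id0 ?div0p // mulrC divpK //.
  by rewrite dvdp_XsubCl rootE -coef_spec Bk0 coef0.
have q0 : q != 0 by apply: contraNneq c0 => q0; rewrite Ec q0 mul0r.
apply: (IHn q B1) => //.
  by rewrite -ltnS (leq_trans _ sc) // Ec size_Mmonic ?monicXsubC // size_XsubC addn2.
apply: (@mulfI _ ('X - k0%:P)%:P); first by rewrite polyC_eq0.
by rewrite mul_polyC scalerA mulrA mul_polyC -EB mulrC -Ec E mulrC.
Qed.

(* The curve G = 0 has no isolated point off the lines k = k0 it contains:
   G divides a multiple c P^n with c a polynomial in k, and the zero of c at k0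
   cancels because k - k0 is a prime not dividing G. *)
Lemma vanish_generic G P T k0 r0 :
  T != 0 -> (forall k r, T.[k] != 0 -> (spec k G).[r] = 0 -> (spec k P).[r] = 0) ->
  spec k0 G != 0 -> (spec k0 G).[r0] = 0 -> (spec k0 P).[r0] = 0.
Proof.
move=> T0 GP Gk0 Gr0.
have G0 : G != 0 by apply: contraNneq Gk0 => ->; rewrite /spec rmorph0.
(* Pseudo-division [l *: P ^+ n = Q * G + R]; the exponent is the one required by
   [dvdp_exp_roots]. *)
pose n := size G; have := Pdiv.Idomain.divp_eq (P ^+ n) G.
set l := lead_coef G ^+ _; set Q := _ %/ G; set R := _ %% G => E.
have l0 : l != 0 by rewrite expf_neq0 // lead_coef_eq0.
(* For generic k the specialized G divides that of [P ^+ n], hence that of [R], whose degree is too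
   small unless it is zero. *)
have R0 : R = 0.
  apply/polyP => i; rewrite coef0; apply: (@poly_eq0_generic _ (T * lead_coef G)).
    by rewrite mulf_neq0 ?lead_coef_eq0.
  move=> k; rewrite hornerM mulf_eq0 negb_or => /andP[Tk lk].
  rewrite -coef_spec; suff -> : spec k R = 0 by rewrite coef0.
  have sGk := size_spec lk.
  have Gk : spec k G != 0 by rewrite -size_poly_eq0 sGk size_poly_eq0.
  have dvd : spec k G %| spec k P ^+ n.
    rewrite /n -sGk; apply: dvdp_exp_roots => // r /eqP Gr; apply/eqP.
    exact: GP.
  have sR : (size (spec k R) < size (spec k G))%N.
    rewrite sGk (leq_ltn_trans (size_poly _ _)) //.
    by rewrite Pdiv.Idomain.ltn_modp.
  have /eqP -> : spec k R == spec k R %% spec k G by rewrite modp_small.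
  have -> : spec k R = l.[k] *: spec k P ^+ n - spec k Q * spec k G.
    by rewrite -specX -specZ E specD specM addrC addKr.
  apply/modp_eq0P; rewrite dvdp_sub ?dvdp_mull //.
  by rewrite -mul_polyC dvdp_mull.
rewrite R0 addr0 in E.
have [c' [B' [ck0 E']]] := primitive_cancel l0 Gk0 E.
have /eqP := congr1 (fun X => (spec k0 X).[r0]) E'.
rewrite /= specZ specM specX hornerZ hornerM Gr0 mulr0 mulf_eq0 (negPf ck0) /=.
by rewrite horner_exp expf_eq0 => /andP[_ /eqP].
Qed.

(* The resultant of G and its shift by e is a polynomial in k, nonzero at k0. *)
Lemma generic_no_common_root G e k0 :
  (lead_coef G).[k0] != 0 ->
  (forall r, (spec k0 G).[r] = 0 -> (spec k0 G).[r + e] != 0) ->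
  exists2 T, T != 0 & forall k r, T.[k] != 0 ->
    (spec k G).[r] = 0 -> (spec k G).[r + e] != 0.
Proof.
move=> lk0 norootk0; pose H := G \Po ('X + e%:P%:P).
have lH : lead_coef H = lead_coef G.
  by rewrite lead_coef_comp ?size_XaddC // lead_coefXaddC expr1n mulr1.
have G0 : G != 0 by apply: contraNneq lk0 => ->; rewrite lead_coef0 horner0.
have coGH : coprimep G H.
  rewrite -resultant_neq0_coprimep //.
  suff : (resultant G H).[k0] != 0 by apply: contraNneq => ->; rewrite horner0.
  (* Neither leading coefficient vanishes at k0, so the resultant commutes with specialization. *)
  rewrite -horner_evalE map_resultant /horner_eval ?lH // -/(spec k0 G) -/(spec k0 H).
  rewrite resultant_neq0_coprimep; last first.
    by rewrite -size_poly_eq0 size_spec // size_poly_eq0.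
  apply/Pdiv.ClosedField.coprimepP => r /eqP Gr.
  by have := norootk0 r Gr; rewrite -horner_spec_shift.
have /Pdiv.Idomain.Bezout_coprimepP[[u v] /= E] := coGH.
(* [T] is a combination of [G] and [H] free of r, so it vanishes at every k where they have a common
   root. *)
have /size_poly1P[T T0 ET] : size (u * G + v * H) == 1%N.
  by rewrite (eqp_size E) size_poly1.
exists T => // k r Tk Gr; rewrite -horner_spec_shift; apply/eqP => Hr.
have := congr1 (fun X => (spec k X).[r]) ET.
rewrite /= specD !specM specC hornerC hornerD !hornerM Gr Hr !mulr0 addr0.
by move=> E0; rewrite -E0 eqxx in Tk.
Qed.

End Families.

Lemma sqrt_exists (K : closedFieldType) (c : K) : exists x, x ^+ 2 = c.
Proof.
have [x] := solve_monicpoly (fun i => if i == 0%N then c else 0) (isT : (0 < 2)%N).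
by rewrite big_ord_recl big_ord1 /= mul0r addr0 mulr1; exists x.
Qed.

(** * Lines through the focus *)

Section Line.
Variable K : closedFieldType.
Variables (a b : K) (v : K * K).
Hypothesis v1 : v.1 ^+ 2 + v.2 ^+ 2 = 1.

Let ell : {mpoly K[2]} :=
  v.2%:MP * ('X_ord2_0 - a%:MP) - v.1%:MP * ('X_ord2_1 - b%:MP).
Let tau : {mpoly K[2]} :=
  v.1%:MP * ('X_ord2_0 - a%:MP) + v.2%:MP * ('X_ord2_1 - b%:MP).

Let ev2_ell y : ev2 ell y = v.2 * (y.1 - a) - v.1 * (y.2 - b).
Proof.
rewrite /ell -[_%:MP * (_ - b%:MP)]opprK opprK -!mulNr -!mpolyCN.
by rewrite !(ev2D, ev2M, ev2C, ev2X0, ev2X1) mulNr.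
Qed.
Let ev2_tau y : ev2 tau y = v.1 * (y.1 - a) + v.2 * (y.2 - b).
Proof.
by rewrite /tau -!mpolyCN !(ev2D, ev2M, ev2C, ev2X0, ev2X1).
Qed.

(* (ell, tau) are orthonormal coordinates centered at (a, b). *)
Lemma line_division (p : {mpoly K[2]}) :
  exists h (g : {poly K}), p = ell * h + (map_poly (@mpolyC 2 K) g).[tau].
Proof.
have v1' : 1 = (v.1 ^+ 2 + v.2 ^+ 2)%:MP :> {mpoly K[2]} by rewrite v1.
rewrite rmorphD !rmorphXn /= in v1'.
elim/mpoly2_ind: p => [c|||p q [h [g Ep]] [h' [g' Eq]]|p q [h [g Ep]] [h' [g' Eq]]].
- by exists 0, c%:P; rewrite mulr0 add0r map_polyC hornerC.
- exists v.2%:MP, (v.1 *: 'X + a%:P).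
  rewrite rmorphD /= map_polyC hornerD hornerC map_polyZ map_polyX hornerZ hornerX.
  rewrite -[LHS]mulr1 [in LHS]v1' /= /ell /tau.
  rewrite -[X in _ = _ + (_ + X)]mulr1 [X in _ = _ + (_ + _ * X)]v1'; ring.
- exists (- v.1%:MP), (v.2 *: 'X + b%:P).
  rewrite rmorphD /= map_polyC hornerD hornerC map_polyZ map_polyX hornerZ hornerX.
  rewrite -[LHS]mulr1 [in LHS]v1' /= /ell /tau.
  rewrite -[X in _ = _ + (_ + X)]mulr1 [X in _ = _ + (_ + _ * X)]v1'; ring.
- by exists (h + h'), (g + g'); rewrite rmorphD hornerD Ep Eq; ring.
- exists (ell * h * h' + h * (map_poly (@mpolyC 2 K) g').[tau]
          + (map_poly (@mpolyC 2 K) g).[tau] * h'), (g * g').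
  by rewrite rmorphM hornerM Ep Eq; ring.
Qed.

Let ev2_horner g y : ev2 (map_poly (@mpolyC 2 K) g).[tau] y = g.[ev2 tau y].
Proof.
elim/poly_ind: g => [|g c IHg]; first by rewrite rmorph0 !horner0 -mpolyC0 ev2C.
rewrite rmorphD rmorphM /= map_polyX map_polyC !hornerMXaddC.
by rewrite ev2D ev2M IHg ev2C.
Qed.

(** Restricting f to the line kills the remainder [g], so [ell] divides f. Irreducibility makes the
    cofactor a constant, nonzero since f is. *)
Lemma curve_line (f : {mpoly K[2]}) :
  mirreducible f -> (forall r, ev2 f (a + r * v.1, b + r * v.2) = 0) ->
  forall y, curve f y <-> v.2 * y.1 + - v.1 * y.2 + (v.1 * b - v.2 * a) = 0.
Proof.
move=> [sf irrf] f0; have [h [g Ef]] := line_division f.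
have tau_line r : ev2 tau (a + r * v.1, b + r * v.2) = r.
  rewrite ev2_tau /=; transitivity (r * (v.1 ^+ 2 + v.2 ^+ 2)); first by ring.
  by rewrite v1 mulr1.
have g0 : g = 0.
  apply: (@poly_eq0_generic _ _ 1); first exact: oner_neq0.
  move=> r _; have := f0 r; rewrite Ef ev2D ev2M ev2_ell ev2_horner tau_line /= => <-.
  by ring.
rewrite g0 rmorph0 horner0 addr0 in Ef.
have [sl|sh] := irrf _ _ Ef.
  have ev_ell := ev2_ell; rewrite (msize1_polyC sl) in ev_ell.
  (* [ell] is not constant: it is 0 at the first point and 1 at the second. *)
  have := ev_ell (a, b); have := ev_ell (a + v.2, b - v.1); rewrite !ev2C /= => ->.
  move=> E; have : v.1 ^+ 2 + v.2 ^+ 2 = 0.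
    by transitivity (v.2 * (a - a) - v.1 * (b - b)); [rewrite -E|]; ring.
  by move/eqP; rewrite v1 oner_eq0.
have h0 : h@_0 != 0.
  apply: contraTneq sf => h0; rewrite Ef (msize1_polyC sh) h0 mpolyC0 mulr0.
  by rewrite msize0.
move=> y; rewrite /curve Ef (msize1_polyC sh) ev2M ev2C ev2_ell.
have -> : v.2 * (y.1 - a) - v.1 * (y.2 - b)
    = v.2 * y.1 + - v.1 * y.2 + (v.1 * b - v.2 * a) by ring.
by split=> [/eqP|->]; rewrite ?mul0r // mulf_eq0 (negPf h0) orbF => /eqP.
Qed.

End Line.

(** * Polar coordinates *)

Section Polar.
Variable K : closedFieldType.
Variables (a b im : K).
Hypothesis two_neq0 : 2 != 0 :> K.
Hypothesis imE : im ^+ 2 = -1.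

(** For nonzero k this is the unit vector u with [u.1 + im * u.2 = k] and
    [u.1 - im * u.2 = k^-1]. *)
Definition dir (k : K) : K * K := ((k + k^-1) / 2, (k - k^-1) / (2 * im)).
Definition pt (k r : K) : K * K := (a + r * (dir k).1, b + r * (dir k).2).

Let pt1 k r : (pt k r).1 = a + r * (dir k).1. Proof. by []. Qed.
Let pt2 k r : (pt k r).2 = b + r * (dir k).2. Proof. by []. Qed.

Let im0 : im != 0.
Proof. by apply: contraTneq (oner_neq0 K) => i0; rewrite -oppr_eq0 -imE i0 expr0n eqxx. Qed.
Let imV : im^-1 = - im.
Proof. by apply: (mulfI im0); rewrite mulfV // mulrN -expr2 imE opprK. Qed.

Let dirE k : dir k = ((k + k^-1) / 2, - im * (k - k^-1) / 2).
Proof. by rewrite /dir invfM imV; congr (_, _); ring. Qed.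

Lemma dir_norm k : k != 0 -> (dir k).1 ^+ 2 + (dir k).2 ^+ 2 = 1.
Proof.
move=> k0; rewrite dirE /=.
transitivity (((k + k^-1) ^+ 2 + im ^+ 2 * (k - k^-1) ^+ 2) / 2 / 2).
  by field; rewrite two_neq0.
by rewrite imE; field; rewrite two_neq0.
Qed.

Lemma pt_norm k r : k != 0 -> ((pt k r).1 - a) ^+ 2 + ((pt k r).2 - b) ^+ 2 = r ^+ 2.
Proof.
move=> k0; rewrite pt1 pt2 ![_ + _ - _]addrC !addKr !(exprMn 2 r) -mulrDr.
by rewrite dir_norm ?mulr1.
Qed.

Lemma pt_isotropic k r : ((pt k r).1 - a) + im * ((pt k r).2 - b) = r * k.
Proof.
rewrite /pt dirE /= ![_ + _ - _]addrC !addKr.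
transitivity (r * ((k + k^-1) - im ^+ 2 * (k - k^-1)) / 2); first by ring.
rewrite imE; transitivity (r * k * (2 / 2)); first by ring.
by rewrite divff ?mulr1.
Qed.

Lemma ptN k r : pt (- k) (- r) = pt k r.
Proof. by rewrite /pt /dir /= invrN; congr (_, _); ring. Qed.

(** The squared distance to A gives r up to sign, and the isotropic coordinate [r * k] then gives
    k. *)
Lemma pt_inj k r k' r' : r != 0 -> k != 0 -> k' != 0 -> pt k r = pt k' r' ->
  (k' = k /\ r' = r) \/ (k' = - k /\ r' = - r).
Proof.
move=> r0 k0 k'0 E.
have Eu : r * k = r' * k' by rewrite -(pt_isotropic k r) -(pt_isotropic k' r') E.
have /eqP : r' ^+ 2 = r ^+ 2 by rewrite -(pt_norm r k0) E pt_norm.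
rewrite eqf_sqr => /orP[] /eqP Er; [left|right]; split=> //; rewrite Er in Eu.
  by apply: (mulfI r0).
by apply: (mulfI r0); rewrite mulrN Eu mulNr opprK.
Qed.

Lemma pt_surj y : (y.1 - a) ^+ 2 + (y.2 - b) ^+ 2 != 0 ->
  exists k r, [/\ k != 0, r != 0 & y = pt k r].
Proof.
move=> Ny; have [r Er] := sqrt_exists ((y.1 - a) ^+ 2 + (y.2 - b) ^+ 2).
have r0 : r != 0 by apply: contraNneq Ny => r0; rewrite -Er r0 expr0n.
set u := (y.1 - a) + im * (y.2 - b); set w := (y.1 - a) - im * (y.2 - b).
have uw : u * w = r ^+ 2.
  by rewrite Er -[RHS]opprK /u /w; transitivity ((y.1 - a) ^+ 2 - im ^+ 2 * (y.2 - b) ^+ 2);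
    [ring|rewrite imE; ring].
have u0 : u != 0.
  by apply: contraNneq r0 => u0; rewrite -sqrf_eq0 -uw u0 mul0r.
exists (u / r), r; split=> //; first by rewrite mulf_neq0 ?invr_eq0.
rewrite /pt dirE invfM invrK /=.
have -> : u^-1 * r = w / r.
  by apply: (mulfI u0); rewrite mulrA mulfV // mul1r mulrA uw expr2 mulfK.
have Ew (c : K) : c / 2 * 2 = c by rewrite divfK.
rewrite [LHS]surjective_pairing; congr (_, _).
  have -> : r * ((u / r + w / r) / 2) = (u + w) / 2 by field; rewrite two_neq0.
  by rewrite /u /w; field; rewrite two_neq0.
have -> : r * (- im * (u / r - w / r) / 2) = - im * (u - w) / 2 by field; rewrite two_neq0.
transitivity (b - im ^+ 2 * (y.2 - b)); first by rewrite imE; ring.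
by rewrite /u /w; field; rewrite two_neq0.
Qed.

(** Collinearity gives x - y = t (y - A), and the distance condition gives t r = d or t r = -d. The
    second case is turned into the first by changing the signs of k and r. *)
Lemma fiber_pt (f : {mpoly K[2]}) d x y : fiber f a b d x y ->
  exists k r, [/\ k != 0, r != 0, ev2 f (pt k r) = 0, y = pt k r & x = pt k (r + d)].
Proof.
case=> w [fy xy cross wN].
have Ny : (y.1 - a) ^+ 2 + (y.2 - b) ^+ 2 != 0.
  by apply: contraTneq (oner_neq0 K) => N0; rewrite -wN N0 mulr0 eqxx.
have [k [r [k0 r0 Ey]]] := pt_surj Ny.
pose t := ((y.1 - a) * (x.1 - y.1) + (y.2 - b) * (x.2 - y.2)) * w.
have x1 : x.1 - y.1 = t * (y.1 - a).
  rewrite -[LHS]mulr1 -wN /t.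
  transitivity (((y.1 - a) * (x.1 - y.1) + (y.2 - b) * (x.2 - y.2)) * w * (y.1 - a)
    + w * (y.2 - b) * ((y.2 - b) * (x.1 - y.1) - (y.1 - a) * (x.2 - y.2))); first by ring.
  by rewrite cross mulr0 addr0.
have x2 : x.2 - y.2 = t * (y.2 - b).
  rewrite -[LHS]mulr1 -wN /t.
  transitivity (((y.1 - a) * (x.1 - y.1) + (y.2 - b) * (x.2 - y.2)) * w * (y.2 - b)
    - w * (y.1 - a) * ((y.2 - b) * (x.1 - y.1) - (y.1 - a) * (x.2 - y.2))); first by ring.
  by rewrite cross mulr0 subr0.
have Ex : x = pt k (r + t * r).
  rewrite [LHS]surjective_pairing -(subrK y.1 x.1) -(subrK y.2 x.2) x1 x2 Ey !pt1 !pt2.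
  by congr (_, _); ring.
have : (t * r) ^+ 2 = d ^+ 2.
  by rewrite -xy x1 x2 !exprMn -mulrDr Ey pt_norm.
move/eqP; rewrite eqf_sqr => /orP[] /eqP Et.
  by exists k, r; rewrite -Et -Ey.
exists (- k), (- r); rewrite !oppr_eq0 ptN -Ey; split=> //.
by rewrite Ex -ptN Et; congr (pt _ _); ring.
Qed.

Lemma pt_fiber (f : {mpoly K[2]}) d k r : k != 0 -> r != 0 ->
  ev2 f (pt k r) = 0 -> fiber f a b d (pt k (r + d)) (pt k r).
Proof.
move=> k0 r0 fy; exists (r ^+ 2)^-1; split=> //; last first.
- by rewrite pt_norm // mulVf // sqrf_eq0.
- by rewrite !pt1 !pt2; ring.
- rewrite !pt1 !pt2; transitivity (d ^+ 2 * ((dir k).1 ^+ 2 + (dir k).2 ^+ 2)); first by ring.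
  by rewrite dir_norm // mulr1.
Qed.

(** The coordinates of [pt k r] are Laurent polynomials in k, so a power of k clears the
    denominators. *)
Lemma polar_poly (p : {mpoly K[2]}) : exists n P, forall k r, k != 0 ->
  (spec k P).[r] = k ^+ n * ev2 p (pt k r).
Proof.
elim/mpoly2_ind: p => [c|||p q [n [P EP]] [m [Q EQ]]|p q [n [P EP]] [m [Q EQ]]].
- by exists 0%N, c%:P%:P => k r k0; rewrite specC !hornerC mul1r ev2C.
- exists 1%N, ((a *: 'X)%:P + ((2^-1)%:P * ('X ^+ 2 + 1))%:P * 'X) => k r k0.
  rewrite specD specM !specC spec_X !hornerE ev2X0 /pt /=; field.
  by rewrite two_neq0.
- exists 1%N, ((b *: 'X)%:P + ((2 * im)^-1%:P * ('X ^+ 2 - 1))%:P * 'X) => k r k0.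
  rewrite specD specM !specC spec_X !hornerE ev2X1 /pt /=; field.
  by rewrite two_neq0 im0 k0.
- exists (n + m)%N, (('X ^+ m)%:P * P + ('X ^+ n)%:P * Q) => k r k0.
  rewrite specD !specM !specC !hornerE EP // EQ // ev2D exprD; ring.
- exists (n + m)%N, (P * Q) => k r k0.
  by rewrite specM hornerM EP // EQ // ev2M exprD; ring.
Qed.

End Polar.

(** * Exceptional distances and density of the points with one preimage *)

Theorem theorem4 (K : closedFieldType) (charK0 : [pchar K] =i pred0)
  (f : {mpoly K[2]}) (a b : K)
  (Hf : mirreducible f)
  (HC0 : exists p : K * K, curve f p /\ (p.1 - a) ^+ 2 + (p.2 - b) ^+ 2 != 0)
  (Hcirc : forall r : K,
      ~ (forall y : K * K, curve f y <-> (y.1 - a) ^+ 2 + (y.2 - b) ^+ 2 = r ^+ 2))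
  (Hline : forall al be ga : K, (al, be) != (0, 0) -> al * a + be * b + ga = 0 ->
      ~ (forall y : K * K, curve f y <-> al * y.1 + be * y.2 + ga = 0)) :
  exists s : seq K, forall d : K, d != 0 -> d \notin s ->
    forall M : K * K -> Prop, irr_component M (conchoid f a b d) ->
      simple_comp f a b d M.
Proof.
have two_neq0 : 2 != 0 :> K by have/pcharf0P-> := charK0.
have [im imE] := sqrt_exists (-1 : K).
have [n [G EG]] := polar_poly a b two_neq0 imE f.
have rootG k r : k != 0 -> (spec k G).[r] = 0 <-> ev2 f (pt a b im k r) = 0.
  move=> k0; rewrite EG //; split=> [/eqP|->]; last by rewrite mulr0.
  by rewrite mulf_eq0 expf_eq0 (negPf k0) andbF => /eqP.
(* Otherwise C contains, hence equals, the line through A with direction [dir k]. *)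
have Gk_neq0 k : k != 0 -> spec k G != 0.
  move=> k0; apply/eqP => Gk0; have N := dir_norm two_neq0 imE k0.
  apply: (Hline _ _ _ _ _ (curve_line (a := a) (b := b) N Hf _)).
  - rewrite xpair_eqE oppr_eq0; apply/negP => /andP[/eqP v2 /eqP v1].
    by move/eqP: N; rewrite v1 v2 expr0n addr0 eq_sym oner_eq0.
  - by ring.
  - by move=> r; apply/(rootG k r k0); rewrite Gk0 horner0.
have G0 : G != 0.
  by apply: contraNneq (Gk_neq0 1 (oner_neq0 K)) => ->; rewrite /spec rmorph0.
have /closed_nonrootP[k0] : 'X * lead_coef G != 0.
  by rewrite mulf_neq0 ?polyX_eq0 ?lead_coef_eq0.
rewrite rootE hornerM hornerX mulf_eq0 negb_or => /andP[k0_neq0 lk0].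
have [rs Ers] := closed_field_poly_normal (spec k0 G).
have rootrs r : (spec k0 G).[r] = 0 -> r \in rs.
  move=> /eqP; rewrite -[_ == 0]/(root _ r) Ers rootZ ?lead_coef_eq0 ?Gk_neq0 //.
  by rewrite root_prod_XsubC.
(* The half-differences keep [d * 2] from being a difference of two roots at [k0]; the opposites
   keep [- d] from being a root there. *)
exists ([seq (r - r') / 2 | r <- rs, r' <- rs] ++ [seq - r | r <- rs]) => d _.
rewrite mem_cat negb_or => /andP[nd1 nd2] M [irrM MZ maxM].
have [T1 T10 T1P] : exists2 T, T != 0 & forall k r, T.[k] != 0 ->
    (spec k G).[r] = 0 -> (spec k G).[r + d * 2] != 0.
  apply: generic_no_common_root lk0 _ => r /rootrs rr; apply: contraNneq nd1 => /rootrs rr'.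
  by apply/allpairsP; exists (r + d * 2, r); rewrite rr rr' addrAC subrr add0r mulfK.
(* [T2] vanishes at k exactly when [- d] is a root on the line k, the radius whose translate by d is
   A. *)
pose T2 := G.[(- d)%:P].
have T20 : T2 != 0.
  apply: contraNneq nd2 => T20; apply/mapP; exists (- d); rewrite ?opprK //.
  by apply: rootrs; rewrite horner_spec -/T2 T20 horner0.
pose S x := exists! y, fiber f a b d x y.
have goodS k r : k != 0 -> T1.[k] != 0 -> T2.[k] != 0 -> r != 0 ->
    (spec k G).[r] = 0 -> S (pt a b im k (r + d)).
  move=> k0' T1k T2k r0 Gr; exists (pt a b im k r); split.
    by apply: pt_fiber => //; apply/rootG.
  move=> y /(fiber_pt two_neq0 imE)[k' [r' [k'0 r'0 fy -> Ex]]].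
  have rd : r + d != 0.
    apply: contraNneq T2k => /eqP; rewrite addr_eq0 => /eqP Er.
    by rewrite -horner_spec -Er Gr.
  (* Equal signs give the same preimage; opposite signs give r' = -(r + 2d), so r + 2d is also a
     root, which [T1] excludes. *)
  case: (pt_inj two_neq0 imE rd k0' k'0 Ex) => -[Ek Er]; first by rewrite Ek (addIr _ Er).
  have := T1P k r T1k Gr; suff -> : (spec k G).[r + d * 2] = 0 by rewrite eqxx.
  apply/rootG => //; rewrite -fy Ek -ptN; congr (ev2 f (pt _ _ _ _ _)).
  by rewrite -[r'](addrK d) Er; ring.
have ZS x : conchoid f a b d x <-> zclosure S x.
  split; apply: zclosure_min; try exact: zclosed_zclosure; last first.
    by move=> x' [y [[w xyw] _]]; apply: zclosureS; exists y, w.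
  move=> x' [y xy]; apply/zclosureP => p pS.
  have [k [r [k_neq0 r_neq0 fy _ ->]]] := fiber_pt two_neq0 imE xy.
  have [m [P EP]] := polar_poly a b two_neq0 imE p.
  have T0 : 'X * T1 * T2 != 0 by rewrite !mulf_neq0 ?polyX_eq0.
  (* The outer factor ['X], in the variable r, covers r = 0, where [goodS] does not apply; it is
     cancelled below since the actual r is nonzero. *)
  have vanish : (spec k ('X * (P \Po ('X + d%:P%:P)))).[r] = 0.
    apply: (vanish_generic T0 _ (Gk_neq0 k k_neq0)); last by apply/rootG.
    move=> k' r'; rewrite !hornerM hornerX !mulf_eq0 !negb_or -andbA => /and3P[k'0 T1k T2k] Gr.
    rewrite specM spec_X hornerM hornerX horner_spec_shift EP //.
    have [->|r'0] := eqVneq r' 0; first by rewrite mul0r.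
    by rewrite pS ?mulr0 //; apply: goodS.
  move/eqP: vanish; rewrite specM spec_X hornerM hornerX horner_spec_shift EP //.
  by rewrite !mulf_eq0 (negPf r_neq0) expf_eq0 (negPf k_neq0) andbF => /eqP.
(* Maximality of the component M forces [N] to equal M, so [S] is dense in M. *)
have [N [irrN MN NZ NE]] := dense_irreducible ZS irrM MZ.
have NM := maxM N irrN MN NZ.
have ME x : M x <-> N x by split; [apply: MN|apply: NM].
exists (fun x => S x /\ N x); split.
- by move=> q [_ /NM].
(* The closure of the empty set is empty, whereas [N] has a point. *)
- apply: NNPP => noS; case: irrM => _ [x /MN/NE Nx] _.
  by apply: (zclosure_min (@zclosed0 K) _ Nx) => y Sy; apply: noS; exists y.
- by move=> q; rewrite ME NE.
- by move=> q [].
Qed.
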